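(* Let $\mathbb{T}\colon\mathbb{R}^d\to\mathbb{R}^d$ be nonexpansive with a fixed point $x_\star=\mathbb{T}(x_\star)$, and let $N\ge 2$ be an integer. Let $\mathbb{T}_0,\dots,\mathbb{T}_{N-2}$ be jointly measurable random maps $\mathbb{R}^d\to\mathbb{R}^d$, independent across the index $k$, and let $\sigma_0^2,\dots,\sigma_{N-2}^2\ge 0$ be deterministic numbers such that for every $k=0,\dots,N-2$ and all deterministic $u,v\in\mathbb{R}^d$, $$\mathbb{E}\left[\|\mathbb{T}_k(u)-\mathbb{T}(v)\|^2\right]\le\|u-v\|^2+\sigma_k^2,\qquad \mathbb{E}\left[\|\mathbb{T}_k(u)-\mathbb{T}_k(v)\|^2\right]\le\|u-v\|^2 .$$ Let $x_0\in\mathbb{R}^d$ be deterministic with $\|x_0-x_\star\|\le D$, and let $x_1,\dots,x_{N-1}$ be generated by $$x_{k+1}=x_k+\frac{N-k-1}{N-k}\left(\mathbb{T}_k(x_k)-\mathbb{T}_{k-1}(x_{k-1})\right),\qquad k=0,\dots,N-2,$$ with the convention $\mathbb{T}_{-1}(x_{-1}):=x_0$. Then, with $a_{N,k}=\frac{1}{(N-k)(N-k-1)}$, $$\mathbb{E}\left[\|x_{N-1}-\mathbb{T}(x_{N-1})\|^2\right]\le\frac{4D^2}{N^2}+6\sum_{k=0}^{N-2}a_{N,k}\sigma_k^2 .$$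
   Context: $\|\cdot\|$ is the Euclidean norm. A map $\mathbb{T}$ is nonexpansive if $\|\mathbb{T}(x)-\mathbb{T}(y)\|\le\|x-y\|$ for all $x,y\in\mathbb{R}^d$. A jointly measurable random map is a map $\mathbb{T}_k(u)=\mathbb{T}_k(u,\omega)$ that is jointly measurable in $(u,\omega)$. The expectations in the hypotheses are over the randomness in $\mathbb{T}_k$. *)

(* Defs.v *)
From HB Require Import structures.
From mathcomp Require Import all_boot all_order all_algebra.
From mathcomp Require Import all_classical all_reals all_analysis.

Set Implicit Arguments.
Unset Strict Implicit.
Unset Printing Implicit Defensive.

Import Order.TTheory GRing.Theory Num.Theory.
Import numFieldNormedType.Exports.

Local Open Scope classical_set_scope.
Local Open Scope ring_scope.

(* The library norm on ['rV[R]_d] is the sup norm. *)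
Definition enorm (R : realType) (d : nat) (x : 'rV[R]_d) : R :=
  Num.sqrt (\sum_(i < d) x 0 i ^+ 2).

Definition nonexpansive (R : realType) (d : nat) (T : 'rV[R]_d -> 'rV[R]_d) :=
  forall x y : 'rV[R]_d, enorm (T x - T y) <= enorm (x - y).

(* [R^d] with its Borel sigma-algebra; the library topology on row vectors is
   the product topology, hence the Euclidean one. *)
Definition borel_rV (R : realType) (d : nat) :=
  g_sigma_algebraType (@open 'rV[R]_d).

Definition jointly_measurable (R : realType) (d : nat)
    (disp : measure_display) (Omega : measurableType disp)
    (F : 'rV[R]_d -> Omega -> 'rV[R]_d) : Prop :=
  measurable_fun [set: borel_rV R d * Omega]
    (fun p : borel_rV R d * Omega => F p.1 p.2 : borel_rV R d).

Definition is_sub_sigma_algebra (disp : measure_display)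
    (Omega : measurableType disp) (G : set (set Omega)) : Prop :=
  sigma_algebra [set: Omega] G /\ G `<=` measurable.

Definition independent_sigma_algebras (R : realType) (disp : measure_display)
    (Omega : measurableType disp) (P : probability Omega R) (I : finType)
    (G : I -> set (set Omega)) : Prop :=
  forall (J : {set I}) (A : I -> set Omega),
    (forall i, i \in J -> G i (A i)) ->
    P (\bigcap_(i in [set` J]) A i) = (\prod_(i in J) P (A i))%E.

(* The maps [F i] are driven by independent sources of randomness: each [F i]
   is jointly measurable with respect to the Borel sets and a sub-sigma-algebra
   [G i], the [G i] being mutually independent.  Independence of the evaluations
   [F i u] at deterministic points [u] alone would not control [F i] at a random
   point independent of [G i], since it ignores an uncountable family of null
   sets. *)
Definition independent_random_maps (R : realType) (d : nat)
    (disp : measure_display) (Omega : measurableType disp)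
    (P : probability Omega R) (I : finType)
    (F : I -> 'rV[R]_d -> Omega -> 'rV[R]_d) : Prop :=
  exists G : I -> set (set Omega),
    [/\ forall i, is_sub_sigma_algebra (G i),
        independent_sigma_algebras P G &
        forall i, @jointly_measurable R d _ (g_sigma_algebraType (G i)) (F i)].

(* Main.v *)
(* With m = N - k and y_k = T_k(x_k), put z_0 = x_0 and
   z_k = m x_k - (m - 1) y_(k-1).  Then x_(k+1) and z_(k+1) are the convex
   combinations of z_k and y_k with weights (1/m, 1 - 1/m) and (1 - 1/m, 1/m).
   For p = x_(N-1), w = T(p) and a_k = 1/(m(m-1)), a telescoping sum gives, for
   each outcome,
     sum_k a_k (|y_k - w|^2 - |x_k - p|^2)
       = (2/N) <p - w, p - x_0> + (1 - 1/N) |p - w|^2,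
   and nonexpansiveness of T at (p, x_star) turns this into
     |p - w|^2 + 2 sum_k a_k |x_k - p|^2
       <= 4 |x_0 - x_star|^2 / N^2 + 2 sum_k a_k |y_k - w|^2.

   It remains to see that E|y_k - w|^2 <= E|x_k - p|^2 + 3 sigma_k^2, although w
   depends on T_k.  Rerun the iteration with T_k replaced by an independent copy,
   all the other maps being kept, and write y', p', w' for the new values of y_k,
   p and w.  Then
     |y_k - w|^2 + |y' - w'|^2
       <= |y_k - w'|^2 + |y' - w|^2 + |y_k - y'|^2 + |w - w'|^2.
   Both terms on the left have the same law.  On the right, w' is independent of
   T_k and w of its copy, so each of the first two terms is at most
   E|x_k - p|^2 + sigma_k^2; the third is at most 2 sigma_k^2, being twice a
   variance; and the mean-square Lipschitz hypothesis propagates the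
   perturbation through the convex combinations without increasing it, so
   E|w - w'|^2 <= E|p - p'|^2 <= E|y_k - y'|^2. *)
Require Import Defs.
From HB Require Import structures.
From mathcomp Require Import all_boot all_order all_algebra.
From mathcomp Require Import all_classical all_reals all_analysis.
From mathcomp Require Import measurable_realfun zify ring lra.

Set Implicit Arguments.
Unset Strict Implicit.
Unset Printing Implicit Defensive.

Import Order.TTheory GRing.Theory Num.Theory.
Import numFieldNormedType.Exports.

Local Open Scope classical_set_scope.
Local Open Scope ring_scope.

(** * Integration against independent sources *)

(** The joint law of [(X, Y)] agrees with the product of the marginal laws on rectangles, hence
    everywhere; Tonelli does the rest. *)
Lemma integral_indep (R : realType) (d d1 d2 : measure_display)
    (Om : measurableType d) (S1 : measurableType d1) (S2 : measurableType d2)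
    (P : probability Om R) (X : Om -> S1) (Y : Om -> S2)
    (mX : measurable_fun setT X) (mY : measurable_fun setT Y)
    (XY : forall A B, measurable A -> measurable B ->
       P (X @^-1` A `&` Y @^-1` B) = (P (X @^-1` A) * P (Y @^-1` B))%E)
    (h : S1 * S2 -> \bar R) (mh : measurable_fun [set: S1 * S2] h)
    (h0 : forall z, (0 <= h z)%E) :
  (\int[P]_w h (X w, Y w) = \int[P]_w \int[P]_w' h (X w, Y w'))%E.
Proof.
pose X' : {RV P >-> S1} := mfun_Sub (mem_set mX).
pose Y' : {RV P >-> S2} := mfun_Sub (mem_set mY).
have mZ : measurable_fun setT (fun w => (X w, Y w)) by exact: measurable_fun_pair.
pose Z : {RV P >-> (S1 * S2)%type} := mfun_Sub (mem_set mZ).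
transitivity (\int[distribution P Z]_z h z)%E.
  by rewrite ge0_integral_distribution.
transitivity (\int[(distribution P X' \x distribution P Y')%E]_z h z)%E.
  by apply: eq_measure_integral => A mA _; apply/esym/product_measure_unique.
rewrite fubini_tonelli1// ge0_integral_distribution//.
- apply: eq_integral => w _ /=.
  rewrite /fubini_F ge0_integral_distribution//.
  exact: measurableT_comp.
- exact: measurable_fun_fubini_tonelli_F.
- by move=> x; exact: integral_ge0.
Qed.

(** * Independence of one source from all the others *)

Section independent_generation.
Context (R : realType) (d : measure_display) (Om : measurableType d).
Context (P : probability Om R) (I : finType) (G : I -> set (set Om)).
Hypothesis hG : forall i, is_sub_sigma_algebra (G i).
Hypothesis iG : independent_sigma_algebras P G.

(** Generates the sigma-algebra of all the randomness except that of index [k]. *)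
Definition other_events (k : I) : set (set Om) :=
  [set A | exists2 i, i != k & G i A].

(* A pi-system generating [<<s other_events k >>]. *)
Let cylinder (k : I) : set (set Om) :=
  [set A | exists (J : {set I}) (B : I -> set Om), [/\ k \notin J,
     (forall i, G i (B i)) & A = \bigcap_(i in [set` J]) B i]].

Lemma other_events_measurable k : <<s other_events k >> `<=` measurable.
Proof.
apply: smallest_sub; first exact: sigma_algebra_measurable.
by move=> A [i _ GA]; exact: (hG i).2.
Qed.

Let GT i : G i setT.
Proof. by have [[G0 GC _] _] := hG i; rewrite -(setD0 setT); exact: GC. Qed.

Let GI i A B : G i A -> G i B -> G i (A `&` B).
Proof.
have := hG i; case => sG _ GA GB.
rewrite -(sigma_algebra_id sG); apply: (@measurableI _ (g_sigma_algebraType (G i)));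
  exact: sub_sigma_algebra.
Qed.

Let cylinder_setI k : setI_closed (cylinder k).
Proof.
move=> _ _ [J [A [kJ GA ->]]] [K [B [kK GB ->]]].
exists (J :|: K), (fun i => (if i \in J then A i else setT) `&`
                            (if i \in K then B i else setT)); split.
- by rewrite inE negb_or kJ.
- by move=> i; apply: GI; case: ifP.
- apply/seteqP; split=> [w [wA wB] i /= _|w wAB].
    split; case: ifP => // iJ; [exact: wA|exact: wB].
  split=> i /= iJ; have := wAB i; rewrite /= inE iJ ?orbT => /(_ isT) [] //.
Qed.

(** For fixed [B], both sides are finite measures in [A]; they agree on the pi-system [cylinder k],
    hence on the sigma-algebra it generates. *)
Lemma other_events_indep k A B : <<s other_events k >> A -> G k B ->
  P (A `&` B) = (P A * P B)%E.
Proof.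
move=> mA GB.
have mB : measurable B by exact: (hG k).2.
have PB0 : 0 <= fine (P B) by exact/fine_ge0/measure_ge0.
pose m1 : {measure set Om -> \bar R} := mrestr P mB.
pose m2 : {measure set Om -> \bar R} := mscale (NngNum PB0) P.
have cylinder_m : cylinder k `<=` measurable.
  move=> _ [J [C [_ GC ->]]]; apply: fin_bigcap_measurable => // i _.
  exact: (hG i).2.
have sub : <<s other_events k >> `<=` <<s cylinder k >>.
  apply: smallest_sub; first exact: smallest_sigma_algebra.
  move=> C [i ik GC]; apply: sub_sigma_algebra.
  exists [set i]%SET, (fun j => if j == i then C else setT); split.
  - by rewrite inE eq_sym.
  - by move=> j; case: eqP => // ->.
  - apply/seteqP; split=> [w Cw j /=|w]; first by rewrite inE => /eqP ->; rewrite eqxx.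
    by move/(_ i); rewrite /= inE eqxx; exact.
suff : m1 A = m2 A.
  rewrite /m1 /m2 /= /mrestr /mscale/= => ->.
  by rewrite fineK ?fin_num_measure// muleC.
apply: (g_sigma_algebra_measure_unique (cylinder k) cylinder_m (fun=> setT)) => //.
- move=> _; exists (finset.set0 : {set I}), (fun=> setT); split => //.
    by rewrite inE.
  by apply/seteqP; split=> // w _ j /=; rewrite inE.
- by rewrite bigcup_const.
- move=> _ [J [C [kJ GC ->]]].
  rewrite /m1 /m2 /= /mrestr /mscale/= fineK ?fin_num_measure//.
  (* Entering [B] at index [k] turns the event into one intersection over [k |: J]. *)
  pose C' i := if i == k then B else C i.
  have GC' i : G i (C' i) by rewrite /C'; case: eqP => // ->.
  have -> : \bigcap_(i in [set` J]) C i = \bigcap_(i in [set` J]) C' i.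
    apply: eq_bigcapr => i /= iJ; rewrite /C'; case: eqP => // ik.
    by rewrite -ik iJ in kJ.
  have -> : \bigcap_(i in [set` J]) C' i `&` B = \bigcap_(i in [set` (k |: J)%SET]) C' i.
    apply/seteqP; split=> [w [wC wB] i /=|w wC].
      by rewrite !inE => /orP[/eqP ->|/wC//]; rewrite /C' eqxx.
    split=> [i /= iJ|]; first by apply: wC; rewrite /= !inE iJ orbT.
    by have := wC k; rewrite /= !inE eqxx /C' eqxx; exact.
  by rewrite !iG// big_setU1//= /C' eqxx.
- by move=> _; rewrite /m1 /= /mrestr setTI ltey_eq fin_num_measure.
- exact: sub.
Qed.

End independent_generation.

(** * Borel measurability of vector-valued maps *)

Lemma enorm_ge0 (R : realType) (n : nat) (u : 'rV[R]_n) : 0 <= enorm u.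
Proof. exact: sqrtr_ge0. Qed.

Lemma enorm_sqr (R : realType) (n : nat) (u : 'rV[R]_n) :
  enorm u ^+ 2 = \sum_(i < n) u 0 i ^+ 2.
Proof. by rewrite sqr_sqrtr// sumr_ge0// => i _; exact: sqr_ge0. Qed.

Lemma measurable_coord (R : realType) (n : nat) (i : 'I_n) :
  measurable_fun [set: borel_rV R n] (fun u : borel_rV R n => (u : 'rV[R]_n) 0 i).
Proof.
apply: (measurability _ (RGenOpens.measurableE R)).
move=> _ [_ [a [b ->] <-]]; rewrite setTI; apply: sub_sigma_algebra.
have /continuousP := @coord_continuous R 1 n 0 i; apply; exact: interval_open.
Qed.

(** An open set is a countable union of balls with rational centre and radius [1/(k+1)]; for the sup
    norm, a ball is a finite intersection of coordinate conditions. *)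
Lemma measurable_rV (R : realType) (n : nat) d (E : measurableType d)
    (f : E -> borel_rV R n) :
  (forall i, measurable_fun setT (fun w => (f w : 'rV[R]_n) 0 i)) ->
  measurable_fun setT f.
Proof.
move=> mf; apply: (@measurability _ _ _ (borel_rV R n) _ _ (@open 'rV[R]_n) erefl).
move=> _ [U oU <-]; rewrite setTI.
pose c (q : 'rV[rat]_n) : 'rV[R]_n := map_mx ratr q.
pose F (z : 'rV[rat]_n * nat) : set E :=
  if `[< ball (c z.1) (z.2.+1%:R^-1) `<=` U >] then
    f @^-1` (ball (c z.1) (z.2.+1%:R^-1)) else set0.
have -> : f @^-1` U = \bigcup_z F z.
  apply/seteqP; split=> [w /= Uw|w [z _]]; last first.
    by rewrite /F; case: asboolP => // sU; exact: sU.
  have /nbhs_ballP[e /= e0 eU] : nbhs (f w : 'rV[R]_n) U by exact: open_nbhs_nbhs.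
  (* A radius below [e / 2] keeps the ball around the rational centre inside the [e]-ball at
     [f w]. *)
  have [k] := @ltr_add_invr R 0 (e / 2) (divr_gt0 e0 (ltr0n _ 2)).
  rewrite add0r => ke.
  have k0 : 0 < k.+1%:R^-1 :> R by rewrite invr_gt0.
  have qex (i : 'I_n) : exists q : rat, `|(f w : 'rV[R]_n) 0 i - ratr q| < k.+1%:R^-1.
    have [|q] := @rat_in_itvoo R ((f w : 'rV[R]_n) 0 i - k.+1%:R^-1)
      ((f w : 'rV[R]_n) 0 i + k.+1%:R^-1); first by rewrite ltrBlDr -addrA ltrDl addr_gt0.
    by rewrite in_itv/= => /andP[? ?]; exists q; rewrite distrC ltr_distl; apply/andP.
  pose q : 'rV[rat]_n := \row_i projT1 (cid (qex i)).
  have qP i j : `|(f w : 'rV[R]_n) i j - c q i j| < k.+1%:R^-1.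
    by rewrite ord1 /c !mxE; case: cid.
  exists (q, k) => //; rewrite /F/=; case: asboolP.
    by move=> _; split=> // i j; apply: ball_sym; exact: qP.
  move=> []; apply: subset_trans eU => v [_ qv]; split=> // i j.
  have := qv i j; have := qP i j; rewrite /ball/= => h1 h2.
  rewrite -(subrKA (c q i j)) (le_lt_trans (ler_normD _ _))//.
  by rewrite [e]splitr; apply: ltrD; [exact: lt_trans h1 ke | exact: lt_trans h2 ke].
apply: countable_bigcupT_measurable => [|z]; first exact: countableP.
rewrite /F; case: asboolP => // _.
have -> : f @^-1` ball (c z.1) (z.2.+1%:R^-1) =
    \bigcap_(i in [set: 'I_n]) ((fun w => (f w : 'rV[R]_n) 0 i) @^-1` ball (c z.1 0 i) (z.2.+1%:R^-1)).
  apply/seteqP; split=> [w [_ wz] i _|w wz]; first exact: wz.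
  split; first by rewrite invr_gt0.
  by move=> i j; rewrite ord1; exact: wz.
apply: fin_bigcap_measurable => // i _; rewrite -[X in measurable X]setTI.
by apply: mf => //; apply: open_measurable; exact: ball_open.
Qed.

(** Continuity suffices, and the Euclidean norm exceeds the sup norm by at most the square root of
    the dimension. *)
Lemma nonexpansive_measurable (R : realType) (n : nat) (T : 'rV[R]_n -> 'rV[R]_n) :
  nonexpansive T -> measurable_fun [set: borel_rV R n] (T : borel_rV R n -> borel_rV R n).
Proof.
move=> hT; apply: (@measurability _ _ _ (borel_rV R n) _ _ (@open 'rV[R]_n) erefl).
move=> _ [U oU <-]; rewrite setTI; apply: sub_sigma_algebra.
rewrite openE => u Uu.
have /nbhs_ballP[e /= e0 eU] : nbhs (T u) U by exact: open_nbhs_nbhs.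
(* Taking [n.+1] instead of [n] covers dimension 0 and makes the final inequality strict. *)
have n1 : 0 < Num.sqrt n.+1%:R :> R by rewrite sqrtr_gt0.
apply/nbhs_ballP; exists (e / Num.sqrt n.+1%:R); first exact: divr_gt0.
move=> v uv; apply: eU; split=> // i j; rewrite ord1; move: j {i} => i.
have le1 : `|T u 0 i - T v 0 i| <= enorm (T u - T v).
  rewrite -sqrtr_sqr ler_sqrt ?sumr_ge0// => [|k _]; last exact: sqr_ge0.
  by rewrite (bigD1 i)//= !mxE lerDl sumr_ge0// => k _; exact: sqr_ge0.
rewrite /ball/=; apply: le_lt_trans le1 _; apply: le_lt_trans (hT u v) _.
rewrite -(ltr_pXn2r (ltn0Sn 1)) ?nnegrE ?enorm_ge0 ?ltW// enorm_sqr.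
have -> : e ^+ 2 = (e / Num.sqrt n.+1%:R) ^+ 2 * n.+1%:R.
  rewrite -[X in _ * X](@sqr_sqrtr R) ?ler0n//.
  by field; rewrite gt_eqF.
apply: (@le_lt_trans _ _ ((e / Num.sqrt n.+1%:R) ^+ 2 * n%:R)); last first.
  by rewrite ltr_pM2l ?ltr_nat// exprn_gt0// divr_gt0.
rewrite mulr_natr -[n in _ *+ n]card_ord -sumr_const.
apply: ler_sum => k _.
have uvk : `|u 0 k - v 0 k| < e / Num.sqrt n.+1%:R by case: uv => _ /(_ 0 k).
rewrite !mxE -[leLHS]real_normK ?num_real//.
by apply: lerXn2r; rewrite ?nnegrE; [exact: normr_ge0|exact/ltW/divr_gt0|exact: ltW].
Qed.

(** * The iteration and its pathwise bound *)

(** The coefficients [a_{N,k}]. *)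
Definition weight (R : realType) (N k : nat) : R :=
  ((N - k)%:R * (N - k - 1)%:R)^-1.

Lemma weight_ge0 (R : realType) (N k : nat) : 0 <= weight R N k.
Proof. by rewrite invr_ge0 mulr_ge0. Qed.

(** * The telescoping identity in one coordinate *)

Section scalar_identity.
Context (R : realType) (n : nat) (X Z Y : nat -> R).
Hypothesis XZ0 : X 0%N = Z 0%N.
Hypothesis XS : forall k, (k < n.+1)%N ->
  X k.+1 = (n.+2 - k)%:R^-1 * Z k + (1 - (n.+2 - k)%:R^-1) * Y k.
Hypothesis ZS : forall k, (k < n.+1)%N ->
  Z k.+1 = (1 - (n.+2 - k)%:R^-1) * Z k + (n.+2 - k)%:R^-1 * Y k.

(* The third term is where the sum telescopes: for [k < n],
   [weight k * ((Y k - p)^2 - (Z k - p)^2)] equals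
   [weight k.+1 * ((X k.+1 - p)^2 - (Z k.+1 - p)^2)]. *)
Lemma partial_weighted_sum (p w : R) (k : nat) : (k <= n)%N ->
  \sum_(0 <= j < k) weight R n.+2 j * ((Y j - w) ^+ 2 - (X j - p) ^+ 2) =
  2 * (p - w) * ((n.+2 - k)%:R^-1 * (Z k - p) - n.+2%:R^-1 * (X 0%N - p))
  + (p - w) ^+ 2 * ((n.+2 - k)%:R^-1 - n.+2%:R^-1)
  + weight R n.+2 k * ((X k - p) ^+ 2 - (Z k - p) ^+ 2).
Proof.
elim: k => [|k IH] kn; first by rewrite big_nil XZ0 subn0; ring.
have kn1 : (k < n.+1)%N by lia.
rewrite big_nat_recr//= IH ?(ltnW kn)// XS// ZS//.
(* Writing [N - k] as [r + 3] removes the truncated subtraction and makes the denominators visibly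
   positive. *)
have [r rE] : exists r, (n - k.+1 = r)%N by exists (n - k.+1)%N.
have mE : (n.+2 - k = r.+3)%N by lia.
have mE1 : (n.+2 - k.+1 = r.+2)%N by lia.
rewrite /weight mE mE1 !subn1/= -!natr1.
have r0 : 0 <= r%:R :> R by [].
have n0 : 0 <= n%:R :> R by [].
field; repeat (apply/andP; split); try lra.
Qed.

(** At the last index [N - k = 2], so [p] is the midpoint of [Z n] and [Y n], and the leftover terms
    combine. *)
Lemma weighted_sum (p w : R) : p = X n.+1 ->
  \sum_(0 <= j < n.+1) weight R n.+2 j * ((Y j - w) ^+ 2 - (X j - p) ^+ 2) =
  2 / n.+2%:R * (p - w) * (p - X 0%N) + (1 - n.+2%:R^-1) * (p - w) ^+ 2.
Proof.
move=> pE; rewrite big_nat_recr//= partial_weighted_sum// pE XS//.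
rewrite /weight (_ : n.+2 - n = 2)%N ?subn1/=; last by lia.
have n0 : 0 <= n%:R :> R by [].
rewrite -!natr1; field; lra.
Qed.

(** The gap is the square of [p - w - 2 / N * (X 0 - s)], with [N = n.+2]. The bracket on the left
    is kept because its sign is known only after summing over coordinates. *)
Lemma weighted_sum_ge (p w s : R) : p = X n.+1 ->
  (p - w) ^+ 2 + 2 / n.+2%:R * ((p - s) ^+ 2 - (w - s) ^+ 2) <=
  4 * (X 0%N - s) ^+ 2 / n.+2%:R ^+ 2 +
  2 * \sum_(0 <= j < n.+1) weight R n.+2 j * ((Y j - w) ^+ 2 - (X j - p) ^+ 2).
Proof.
move=> pE; rewrite weighted_sum// -subr_ge0.
have n0 : n.+2%:R != 0 :> R by [].
rewrite [X in 0 <= X](_ : _ = (p - w - 2 / n.+2%:R * (X 0%N - s)) ^+ 2) ?sqr_ge0//.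
by field.
Qed.

End scalar_identity.

(* The iteration in the variables [(x_k, z_k)], where
   [z_k = (N - k) x_k - (N - k - 1) T_(k-1)(x_(k-1))]; in contrast to the
   recursion for [x_k] alone, both components are convex combinations. *)
Fixpoint dual_iter (R : realType) (d N : nat) (S : nat -> 'rV[R]_d -> 'rV[R]_d)
    (x0 : 'rV[R]_d) (k : nat) : 'rV[R]_d * 'rV[R]_d :=
  if k is j.+1 then
    let: (x, z) := dual_iter N S x0 j in
    let c := (N - j)%:R^-1 in
    (c *: z + (1 - c) *: S j x, c *: S j x + (1 - c) *: z)
  else (x0, x0).

Lemma step_size_itv (R : realType) (N k : nat) : (k < N.-1)%N ->
  (0 <= (N - k)%:R^-1 :> R) && ((N - k)%:R^-1 <= 1 :> R).
Proof.
move=> kN; have Nk : (1 <= N - k)%N by lia.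
by rewrite invr_ge0 ler0n/= invf_le1 ?ler1n// ltr0n.
Qed.

Section dual_iter.
Context (R : realType) (d N : nat) (S : nat -> 'rV[R]_d -> 'rV[R]_d).
Context (x0 : 'rV[R]_d).
Let X k := (dual_iter N S x0 k).1.
Let Z k := (dual_iter N S x0 k).2.

Lemma dual_iterS1 k : X k.+1 =
  (N - k)%:R^-1 *: Z k + (1 - (N - k)%:R^-1) *: S k (X k).
Proof. by rewrite /X /Z /=; case: dual_iter. Qed.

Lemma dual_iterS2 k : Z k.+1 =
  (N - k)%:R^-1 *: S k (X k) + (1 - (N - k)%:R^-1) *: Z k.
Proof. by rewrite /X /Z /=; case: dual_iter. Qed.

(** Sum [weighted_sum_ge] over the coordinates; the bracket in [wps] is then nonnegative, by
    nonexpansiveness at [p] and [s], and is dropped. *)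
Lemma dual_iter_bound (T : 'rV[R]_d -> 'rV[R]_d) (s : 'rV[R]_d) :
  nonexpansive T -> s = T s -> (2 <= N)%N -> forall p, p = X N.-1 ->
  enorm (p - T p) ^+ 2 +
    2 * \sum_(0 <= k < N.-1) weight R N k * enorm (X k - p) ^+ 2 <=
  4 * enorm (x0 - s) ^+ 2 / N%:R ^+ 2 +
    2 * \sum_(0 <= k < N.-1) weight R N k * enorm (S k (X k) - T p) ^+ 2.
Proof.
move=> hT sE N2 p pE.
have [n NE] : exists n, N = n.+2 by exists N.-2; lia.
have wps : 0 <= enorm (p - s) ^+ 2 - enorm (T p - s) ^+ 2.
  by rewrite subr_ge0 lerXn2r ?nnegrE ?enorm_ge0// {1}sE.
suff : enorm (p - T p) ^+ 2 +
    2 / N%:R * (enorm (p - s) ^+ 2 - enorm (T p - s) ^+ 2) <=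
    4 * enorm (x0 - s) ^+ 2 / N%:R ^+ 2 +
    2 * \sum_(0 <= k < N.-1) weight R N k *
      (enorm (S k (X k) - T p) ^+ 2 - enorm (X k - p) ^+ 2).
  under eq_bigr do rewrite mulrBr.
  rewrite big_split/= sumrN => h; have : 0 <= 2 / N%:R *
    (enorm (p - s) ^+ 2 - enorm (T p - s) ^+ 2) by rewrite mulr_ge0// divr_ge0.
  lra.
rewrite (_ : enorm (p - T p) ^+ 2 + _ = \sum_(i < d) ((p - T p) 0 i ^+ 2 + 2 / N%:R *
    ((p - s) 0 i ^+ 2 - (T p - s) 0 i ^+ 2))); last first.
  by rewrite !enorm_sqr -sumrB mulr_sumr -big_split.
rewrite (_ : _ / N%:R ^+ 2 = \sum_(i < d) 4 * (x0 - s) 0 i ^+ 2 / N%:R ^+ 2); last first.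
  by rewrite enorm_sqr mulr_sumr mulr_suml.
rewrite (eq_bigr (fun k => \sum_(i < d) weight R N k *
   ((S k (X k) 0 i - T p 0 i) ^+ 2 - (X k 0 i - p 0 i) ^+ 2))); last first.
  move=> k _; rewrite !enorm_sqr -sumrB mulr_sumr; apply: eq_bigr => i _.
  by rewrite !mxE.
rewrite exchange_big/= mulr_sumr -big_split/=.
apply: ler_sum => i _.
rewrite NE/= !mxE.
apply: (@weighted_sum_ge R n (fun k => X k 0 i) (fun k => Z k 0 i)
   (fun k => S k (X k) 0 i)) => //; last by rewrite pE NE.
- by move=> k _; rewrite dual_iterS1 NE !mxE.
- by move=> k _; rewrite dual_iterS2 NE !mxE addrC.
Qed.

(** The induction carries a formula for [Z k] as well; with [T_(-1)(x_(-1)) = x0] it starts from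
    [Z 0 = N x0 - (N - 1) x0 = x0]. *)
Lemma dual_iterE (x : nat -> 'rV[R]_d) : (0 < N)%N -> x 0%N = x0 ->
  (forall k, (k < N.-1)%N -> x k.+1 = x k + ((N - k - 1)%:R / (N - k)%:R) *:
     (S k (x k) - (if k is j.+1 then S j (x j) else x0))) ->
  forall k, (k <= N.-1)%N -> x k = X k.
Proof.
move=> N0 x00 xS k kN.
suff : x k = X k /\ Z k = (N - k)%:R *: x k - (N - k - 1)%:R *:
    (if k is j.+1 then S j (x j) else x0) by case.
elim: k kN => [_|k IH kN].
  split=> //; rewrite x00 subn0 -scalerBl.
  by rewrite natrB// opprB addrCA subrr addr0 scale1r.
have [xX ZE] := IH (ltnW kN).
(* Here [k + 1 <= N - 1], so [N - k >= 2] and no denominator vanishes. *)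
have [r rE] : exists r, (N - k = r.+2)%N by exists (N - k).-2; lia.
have rE1 : (N - k.+1 = r.+1)%N by lia.
have r2 : r%:R + 1 + 1 != 0 :> R by rewrite !natr1 pnatr_eq0.
rewrite dual_iterS1 dual_iterS2 -xX ZE xS// rE rE1 !subn1/= -!natr1.
move: (if k is j.+1 then S j (x j) else x0) => y.
by split; apply/rowP => i; rewrite !mxE; field.
Qed.

End dual_iter.

(** * Mean-square distances *)

(** The gap is [a (1 - a) |u - v|^2]. *)
Lemma enorm_sqr_convex (R : realType) (n : nat) (a : R) (u v : 'rV[R]_n) :
  0 <= a <= 1 ->
  enorm (a *: u + (1 - a) *: v) ^+ 2 <= a * enorm u ^+ 2 + (1 - a) * enorm v ^+ 2.
Proof.
move=> /andP[a0 a1]; rewrite !enorm_sqr !mulr_sumr -big_split/=.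
apply: ler_sum => i _; rewrite !mxE -subr_ge0.
rewrite [X in 0 <= X](_ : _ = a * (1 - a) * (u 0 i - v 0 i) ^+ 2); last by ring.
by rewrite mulr_ge0 ?sqr_ge0// mulr_ge0// subr_ge0.
Qed.

(** Parallelogram law: the gap is [|u - v|^2]. *)
Lemma enorm_sqrD (R : realType) (n : nat) (u v : 'rV[R]_n) :
  enorm (u + v) ^+ 2 <= 2 * enorm u ^+ 2 + 2 * enorm v ^+ 2.
Proof.
rewrite !enorm_sqr !mulr_sumr -big_split/=.
apply: ler_sum => i _; rewrite !mxE -subr_ge0.
rewrite [X in 0 <= X](_ : _ = (u 0 i - v 0 i) ^+ 2) ?sqr_ge0//; ring.
Qed.

(** The gap is [|(y - y') + (v - v')|^2]. *)
Lemma enorm_sqr_exchange (R : realType) (n : nat) (y y' v v' : 'rV[R]_n) :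
  enorm (y - v) ^+ 2 + enorm (y' - v') ^+ 2 <=
  enorm (y - v') ^+ 2 + enorm (y' - v) ^+ 2 +
    (enorm (y - y') ^+ 2 + enorm (v - v') ^+ 2).
Proof.
rewrite !enorm_sqr -!big_split/=; apply: ler_sum => i _.
rewrite !mxE -subr_ge0.
rewrite [X in 0 <= X](_ : _ = (y 0 i - y' 0 i + (v 0 i - v' 0 i)) ^+ 2) ?sqr_ge0//.
ring.
Qed.

Section measurable_rV_ops.
Context (R : realType) (n : nat) (d : measure_display) (E : measurableType d).
Implicit Types f g : E -> borel_rV R n.

Lemma measurable_rV_coord f i : measurable_fun setT f ->
  measurable_fun setT (fun w => (f w : 'rV[R]_n) 0 i).
Proof. by move=> mf; exact: (measurableT_comp (measurable_coord i) mf). Qed.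

Lemma measurable_rV_lin f g (a b : R) :
  measurable_fun setT f -> measurable_fun setT g ->
  measurable_fun setT
    (fun w => a *: (f w : 'rV[R]_n) + b *: (g w : 'rV[R]_n) : borel_rV R n).
Proof.
move=> mf mg; apply: measurable_rV => i.
rewrite (_ : (fun w => _) = (fun w => a * (f w : 'rV[R]_n) 0 i + b * (g w : 'rV[R]_n) 0 i)).
  by apply: measurable_funD; apply: measurable_funM => //; exact: measurable_rV_coord.
by apply/funext => w; rewrite !mxE.
Qed.

Lemma measurable_enorm_sqrB f g :
  measurable_fun setT f -> measurable_fun setT g ->
  measurable_fun setT
    (fun w => (enorm ((f w : 'rV[R]_n) - (g w : 'rV[R]_n)) ^+ 2)%:E).
Proof.
move=> mf mg; apply/measurable_EFinP.
rewrite (_ : (fun w => _) = fun w =>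
  \sum_(i < n) ((f w : 'rV[R]_n) 0 i - (g w : 'rV[R]_n) 0 i) ^+ 2).
  apply: measurable_sum => i; apply: measurable_funX.
  by apply: measurable_funB; exact: measurable_rV_coord.
by apply/funext => w; rewrite enorm_sqr; apply: eq_bigr => i _; rewrite !mxE.
Qed.

End measurable_rV_ops.

Section mean_square.
Context (R : realType) (n : nat) (d : measure_display) (E : measurableType d).
Variable mu : {measure set E -> \bar R}.
Implicit Types f g h : E -> borel_rV R n.
Local Open Scope ereal_scope.

(** Squared L2 distance, with values in the extended reals so that no integrability is
    presupposed. *)
Definition msq (f g : E -> 'rV[R]_n) : \bar R :=
  \int[mu]_w (enorm (f w - g w) ^+ 2)%:E.

Lemma msq_ge0 f g : 0 <= msq f g.
Proof. by apply: integral_ge0 => w _; rewrite lee_fin sqr_ge0. Qed.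

Lemma msq_refl f : msq f f = 0.
Proof.
apply: integral0_eq => w _; rewrite subrr enorm_sqr big1// => i _.
by rewrite mxE expr0n.
Qed.

Lemma msqC f g : msq f g = msq g f.
Proof.
apply: eq_integral => w _; rewrite !enorm_sqr; congr EFin.
by apply: eq_bigr => i _; rewrite !mxE -sqrrN opprB.
Qed.

Lemma msq_exchange f f' g g' :
  measurable_fun setT f -> measurable_fun setT f' ->
  measurable_fun setT g -> measurable_fun setT g' ->
  msq f g + msq f' g' <= msq f g' + msq f' g + (msq f f' + msq g g').
Proof.
move=> mf mf' mg mg'.
have m := measurable_enorm_sqrB.
have p0 (h h' : E -> 'rV[R]_n) w : setT w -> 0 <= (enorm (h w - h' w) ^+ 2)%:E.
  by rewrite lee_fin sqr_ge0.
rewrite /msq -!ge0_integralD//; try exact: m; try exact: p0;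
  try by [apply: emeasurable_funD; exact: m | move=> w wT; apply: adde_ge0; exact: p0].
apply: ge0_le_integral => //.
- by move=> w wT; apply: adde_ge0; exact: p0.
- by apply: emeasurable_funD; exact: m.
- by do 2?[apply: emeasurable_funD]; apply: m.
- move=> w _; rewrite -!EFinD lee_fin; exact: enorm_sqr_exchange.
Qed.

Lemma msq_nonexpansive (T : 'rV[R]_n -> 'rV[R]_n) f g : nonexpansive T ->
  measurable_fun setT f -> measurable_fun setT g ->
  msq (fun w => T (f w)) (fun w => T (g w)) <= msq f g.
Proof.
move=> hT mf mg; have mT := nonexpansive_measurable hT.
apply: ge0_le_integral => //.
- by move=> w _; rewrite lee_fin sqr_ge0.
- by apply: (@measurable_enorm_sqrB _ _ _ _ (fun w => T (f w)) (fun w => T (g w)));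
    exact: (measurableT_comp mT).
- exact: measurable_enorm_sqrB.
- by move=> w _; rewrite lee_fin lerXn2r ?nnegrE ?enorm_ge0.
Qed.

(** A single bound [M] for both pairs suits the inductions below, where both components of the
    iteration stay within one bound. *)
Lemma msq_convex (a : R) f1 g1 f2 g2 M : (0 <= a <= 1)%R ->
  measurable_fun setT f1 -> measurable_fun setT g1 ->
  measurable_fun setT f2 -> measurable_fun setT g2 ->
  msq f1 g1 <= M -> msq f2 g2 <= M ->
  msq (fun w => a *: (f1 w : 'rV[R]_n) + (1 - a) *: (f2 w : 'rV[R]_n))%R
      (fun w => a *: (g1 w : 'rV[R]_n) + (1 - a) *: (g2 w : 'rV[R]_n))%R <= M.
Proof.
move=> a01 mf1 mg1 mf2 mg2 le1 le2; have /andP[a0 a1] := a01.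
have mfg1 := measurable_enorm_sqrB mf1 mg1.
have mfg2 := measurable_enorm_sqrB mf2 mg2.
have a1' : (0 <= 1 - a)%R by rewrite subr_ge0.
apply: (@le_trans _ _ (a%:E * msq f1 g1 + (1 - a)%:E * msq f2 g2)).
  rewrite /msq -ge0_integralZl_EFin//; last by move=> w _; rewrite lee_fin sqr_ge0.
  rewrite -ge0_integralZl_EFin//; last by move=> w _; rewrite lee_fin sqr_ge0.
  rewrite -ge0_integralD//; first last.
  - by apply: measurable_funeM.
  - by move=> w _; rewrite -EFinM lee_fin mulr_ge0// sqr_ge0.
  - by apply: measurable_funeM.
  - by move=> w _; rewrite -EFinM lee_fin mulr_ge0// sqr_ge0.
  apply: ge0_le_integral => //.
  - by move=> w _; rewrite lee_fin sqr_ge0.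
  - apply: measurable_enorm_sqrB; exact: measurable_rV_lin.
  - by apply: emeasurable_funD; apply: measurable_funeM.
  - move=> w _; rewrite -!EFinM -EFinD lee_fin.
    rewrite opprD addrACA -!scalerBr; exact: enorm_sqr_convex.
have M0 : 0 <= M by apply: le_trans le1; exact: msq_ge0.
apply: (@le_trans _ _ (a%:E * M + (1 - a)%:E * M)).
  by apply: leeD; apply: lee_wpmul2l.
by rewrite -ge0_muleDl// -EFinD addrCA subrr addr0 mul1e.
Qed.

Lemma msq_triangle f g h :
  measurable_fun setT f -> measurable_fun setT g -> measurable_fun setT h ->
  msq f h <= 2%:E * msq f g + 2%:E * msq g h.
Proof.
move=> mf mg mh.
have mfg := measurable_enorm_sqrB mf mg.
have mgh := measurable_enorm_sqrB mg mh.
rewrite /msq -!ge0_integralZl_EFin//; try by move=> w _; rewrite lee_fin sqr_ge0.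
rewrite -ge0_integralD//; first last.
- by apply: measurable_funeM.
- by move=> w _; rewrite -EFinM lee_fin mulr_ge0// sqr_ge0.
- by apply: measurable_funeM.
- by move=> w _; rewrite -EFinM lee_fin mulr_ge0// sqr_ge0.
apply: ge0_le_integral => //.
- by move=> w _; rewrite lee_fin sqr_ge0.
- exact: measurable_enorm_sqrB.
- by apply: emeasurable_funD; apply: measurable_funeM.
- move=> w _; rewrite -!EFinM -EFinD lee_fin.
  rewrite (_ : _ - _ = f w - g w + (g w - h w))%R; first exact: enorm_sqrD.
  by rewrite addrA subrK.
Qed.

End mean_square.

(** The source [E] is arbitrary: it will be [Om] with its full sigma-algebra, [Om] with the coarser
    one from [other_events], or a product. *)
Lemma dual_iter_measurable (R : realType) (n N : nat) (d : measure_display)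
    (E : measurableType d) (F : nat -> 'rV[R]_n -> E -> 'rV[R]_n) (x0 : 'rV[R]_n)
    (k : nat) :
  (forall i, (i < k)%N -> measurable_fun [set: borel_rV R n * E]
     (fun p : borel_rV R n * E => F i p.1 p.2 : borel_rV R n)) ->
  measurable_fun setT
    (fun w : E => (dual_iter N (fun i u => F i u w) x0 k).1 : borel_rV R n) /\
  measurable_fun setT
    (fun w : E => (dual_iter N (fun i u => F i u w) x0 k).2 : borel_rV R n).
Proof.
elim: k => [_|k IH mF]; first by split; exact: measurable_cst.
have [i ik|mX mZ] := IH; first by apply: mF; rewrite ltnW.
have mY : measurable_fun setT (fun w : E =>
    F k (dual_iter N (fun i u => F i u w) x0 k).1 w : borel_rV R n).
  exact: (measurableT_comp (mF k (ltnSn k)) (measurable_fun_pair mX (@measurable_id _ E setT))).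
split.
- under eq_fun do rewrite dual_iterS1; exact: measurable_rV_lin.
- under eq_fun do rewrite dual_iterS2; exact: measurable_rV_lin.
Qed.

(** * Mean-square distance between two independent copies *)

Section mean_square_independent_copies.
Context (R : realType) (d : measure_display) (Om : measurableType d).
Context (P : probability Om R).
Local Open Scope ereal_scope.

Lemma sqr_integrable (g : Om -> R) : measurable_fun setT g ->
  \int[P]_w (g w ^+ 2)%:E < +oo ->
  P.-integrable setT (EFin \o g) /\ P.-integrable setT (fun w => (g w ^+ 2)%:E).
Proof.
move=> mg goo.
have ig2 : P.-integrable setT (fun w => (g w ^+ 2)%:E).
  apply/integrableP; split.
    by apply/measurable_EFinP; exact: measurable_funX.
  by under eq_integral do rewrite gee0_abs ?lee_fin ?sqr_ge0//.
split=> //.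
(* Domination: [|g| <= 1 + g^2], and constants are integrable for a probability. *)
have i1 : P.-integrable setT (fun w => (1 + g w ^+ 2)%:E).
  rewrite (_ : (fun w => _) = (cst 1 \+ (fun w => (g w ^+ 2)%:E))).
    by apply: integrableD => //; exact: finite_measure_integrable_cst.
  by apply/funext => w; rewrite /= EFinD.
apply: le_integrable i1 => //; first exact/measurable_EFinP.
move=> w _ /=; rewrite lee_fin [leRHS]ger0_norm ?addr_ge0 ?sqr_ge0//.
rewrite -[(g w ^+ 2)%R]real_normK ?num_real// -subr_ge0.
set t := `|g w|%R.
rewrite [X in (0 <= X)%R](_ : _ = ((t - 1 / 2) ^+ 2 + 3 / 4)%R).
  by rewrite addr_ge0 ?sqr_ge0.
by field.
Qed.

Lemma integral_quadratic (g : Om -> R) (a b : R) :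
  P.-integrable setT (EFin \o g) -> P.-integrable setT (fun w => (g w ^+ 2)%:E) ->
  \int[P]_w (a + b * g w + g w ^+ 2)%:E =
  (a + b * fine (\int[P]_w (g w)%:E) + fine (\int[P]_w (g w ^+ 2)%:E))%:E.
Proof.
move=> i1 i2.
have ia : P.-integrable setT (cst a%:E) by exact: finite_measure_integrable_cst.
have ib : P.-integrable setT (fun w => b%:E * (g w)%:E) by exact: integrableZl.
rewrite (_ : (fun w => _) = ((cst a%:E \+ (fun w => b%:E * (g w)%:E)) \+ (fun w => (g w ^+ 2)%:E))).
  rewrite integralD//; last exact: integrableD.
  rewrite integralD// integral_cst//= probability_setT mule1.
  rewrite integralZl//.
  by rewrite EFinD EFinD EFinM !fineK//; [exact: integrable_fin_num i2|exact: integrable_fin_num i1].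
by apply/funext => w; rewrite /= !EFinD EFinM.
Qed.

(** The left side is twice the variance, [2 (s - m^2)], when the second moment is finite; otherwise
    the right side is infinite. *)
Lemma sqr_dist_copies_real (g : Om -> R) : measurable_fun setT g ->
  \int[P]_w \int[P]_w' ((g w' - g w) ^+ 2)%:E <= 2%:E * \int[P]_w (g w ^+ 2)%:E.
Proof.
move=> mg.
have [goo|] := ltP (\int[P]_w (g w ^+ 2)%:E) +oo; last first.
  by rewrite leye_eq => /eqP ->; rewrite mulry gtr0_sg// mul1e leey.
have [i1 i2] := sqr_integrable mg goo.
set m := fine (\int[P]_w (g w)%:E); set s := fine (\int[P]_w (g w ^+ 2)%:E).
rewrite (eq_integral (fun w => (s + (- 2 * m) * g w + g w ^+ 2)%:E)); last first.
  move=> w _; rewrite (eq_integral (fun w' => ((g w ^+ 2) + (- 2 * g w) * g w' + g w' ^+ 2)%:E)).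
    by rewrite integral_quadratic// -/m -/s; congr EFin; ring.
  by move=> w' _; congr EFin; ring.
rewrite integral_quadratic// -/m -/s.
have -> : \int[P]_w (g w ^+ 2)%:E = s%:E by rewrite fineK//; exact: integrable_fin_num i2.
rewrite -EFinM lee_fin; have := sqr_ge0 m.
nra.
Qed.

(** Apply the real case to each coordinate of [f - t]; the translation by [t] does not change the
    differences on the left. *)
Lemma sqr_dist_copies (n : nat) (f : Om -> borel_rV R n) (t : 'rV[R]_n) :
  measurable_fun setT f ->
  \int[P]_w \int[P]_w' (enorm ((f w' : 'rV[R]_n) - (f w : 'rV[R]_n)) ^+ 2)%:E <=
  2%:E * msq P f (fun=> t).
Proof.
move=> mf.
pose g i w := ((f w : 'rV[R]_n) 0 i - t 0 i)%R.
have mg i : measurable_fun setT (g i).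
  by apply: measurable_funB; [exact: measurable_rV_coord|exact: measurable_cst].
have mgg i : measurable_fun [set: Om * Om] (fun z => ((g i z.2 - g i z.1) ^+ 2)%:E).
  apply/measurable_EFinP/measurable_funX/measurable_funB; exact: measurableT_comp.
have mgw i w : measurable_fun setT (fun w' => ((g i w' - g i w) ^+ 2)%:E).
  by apply/measurable_EFinP/measurable_funX/measurable_funB => //; exact: measurable_cst.
rewrite /msq [X in _ <= _ * X](eq_integral (fun w => \sum_(i < n) (g i w ^+ 2)%:E)); last first.
  by move=> w _; rewrite enorm_sqr sumEFin; congr EFin; apply: eq_bigr => i _; rewrite !mxE.
rewrite [leLHS](eq_integral (fun w => \sum_(i < n) \int[P]_w' ((g i w' - g i w) ^+ 2)%:E)); last first.
  move=> w _; rewrite -ge0_integral_sum//; last first.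
    by move=> i w' _; rewrite lee_fin sqr_ge0.
  apply: eq_integral => w' _; rewrite enorm_sqr sumEFin; congr EFin.
  by apply: eq_bigr => i _; rewrite !mxE /g; ring.
rewrite !ge0_integral_sum//.
- rewrite ge0_sume_distrr; first by apply: lee_sum => i _; exact: sqr_dist_copies_real.
  by move=> i _; apply: integral_ge0 => w _; rewrite lee_fin sqr_ge0.
- by move=> i; apply/measurable_EFinP/measurable_funX.
- by move=> i w _; rewrite lee_fin sqr_ge0.
- move=> i; apply: (measurable_fun_fubini_tonelli_F (fun z => ((g i z.2 - g i z.1) ^+ 2)%:E)) => //.
  by move=> z; rewrite lee_fin sqr_ge0.
- by move=> i w _; apply: integral_ge0 => w' _; rewrite lee_fin sqr_ge0.
Qed.

End mean_square_independent_copies.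

(** * Replacing one map by an independent copy *)

Lemma eq_dual_iter (R : realType) (d N : nat) (S S' : nat -> 'rV[R]_d -> 'rV[R]_d)
    (x0 : 'rV[R]_d) (k : nat) : (forall i u, (i < k)%N -> S i u = S' i u) ->
  dual_iter N S x0 k = dual_iter N S' x0 k.
Proof.
elim: k => //= k IH SS'; rewrite IH => [|i u ik]; last by rewrite SS'// ltnW.
by case: dual_iter => x z; rewrite SS'.
Qed.

Section mean_square_product.
Context (R : realType) (n : nat) (d : measure_display) (Om : measurableType d).
Context (P : probability Om R).
Variables a b : Om * Om -> borel_rV R n.
Hypotheses (ma : measurable_fun setT a) (mb : measurable_fun setT b).
Local Open Scope ereal_scope.

Let mab := measurable_enorm_sqrB ma mb.
Let ab0 z : 0 <= (enorm ((a z : 'rV[R]_n) - (b z : 'rV[R]_n)) ^+ 2)%:E.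
Proof. by rewrite lee_fin sqr_ge0. Qed.

Lemma msq_prod1 : msq (P \x P) a b =
  \int[P]_w msq P (fun w' => a (w, w')) (fun w' => b (w, w')).
Proof. by rewrite /msq fubini_tonelli1. Qed.

Lemma msq_prod2 : msq (P \x P) a b =
  \int[P]_w' msq P (fun w => a (w, w')) (fun w => b (w, w')).
Proof. by rewrite /msq fubini_tonelli2. Qed.

Lemma measurable_msq1 : measurable_fun setT
  (fun w => msq P (fun w' => a (w, w')) (fun w' => b (w, w'))).
Proof. exact: measurable_fun_fubini_tonelli_F mab ab0. Qed.

Lemma measurable_msq2 : measurable_fun setT
  (fun w' => msq P (fun w => a (w, w')) (fun w => b (w, w'))).
Proof. exact: measurable_fun_fubini_tonelli_G mab ab0. Qed.

End mean_square_product.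

(** * Freezing all sources of randomness but one *)

Section ghost_step.
Context (R : realType) (n : nat) (d : measure_display) (Om : measurableType d).
Context (P : probability Om R) (N : nat).
Variables (T : 'rV[R]_n -> 'rV[R]_n) (F : nat -> 'rV[R]_n -> Om -> 'rV[R]_n).
Variables (G : 'I_N.-1 -> set (set Om)) (sigma2 : nat -> R) (x0 : 'rV[R]_n).
Hypothesis hT : nonexpansive T.
Hypothesis hG : forall i, is_sub_sigma_algebra (G i).
Hypothesis iG : independent_sigma_algebras P G.
Hypothesis mF : forall i, @jointly_measurable R n _ (g_sigma_algebraType (G i)) (F i).
Hypothesis sigma2_ge0 : forall k, (k < N.-1)%N -> 0 <= sigma2 k.
Local Open Scope ereal_scope.
Hypothesis F_var : forall k u v, (k < N.-1)%N ->
  msq P (F k u) (fun=> T v) <= (enorm (u - v) ^+ 2 + sigma2 k)%:E.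
Hypothesis F_lip : forall k u v, (k < N.-1)%N ->
  msq P (F k u) (F k v) <= (enorm (u - v) ^+ 2)%:E.

Local Notation B := (borel_rV R n).
Local Notation Hk k := (g_sigma_algebraType (other_events G k)).
Local Notation Gk k := (g_sigma_algebraType (G k)).

(* The identities below are measurable because they only coarsen the
   sigma-algebra on [Om]. *)
Let idH k : measurable_fun [set: Om] (id : Om -> Hk k).
Proof. by move=> _ A mA; rewrite setTI; exact: (other_events_measurable hG) mA. Qed.

Let idG k : measurable_fun [set: Om] (id : Om -> Gk k).
Proof.
move=> _ A mA; rewrite setTI; apply: (hG k).2.
by rewrite -(sigma_algebra_id (hG k).1).
Qed.

Let idHG k i : i != k -> measurable_fun [set: Hk k] (id : Hk k -> Gk i).
Proof.
move=> ik _ A mA; rewrite setTI; apply: sub_sigma_algebra.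
by exists i => //; rewrite -(sigma_algebra_id (hG i).1).
Qed.

Let idHGprod k : measurable_fun [set: Om * Om] (id : Om * Om -> Hk k * Gk k).
Proof.
apply/measurable_fun_pairP; split.
- exact: (measurableT_comp (@idH k) measurable_fst).
- exact: (measurableT_comp (@idG k) measurable_snd).
Qed.

(** [phi] selects the source driving [F k]: the original outcome, the coordinate carrying the copy,
    or a constant. *)
Let mFsub k (e : measure_display) (E : measurableType e) (phi : E -> Gk k) :
  measurable_fun setT phi ->
  measurable_fun [set: B * E] (fun p : B * E => F k p.1 (phi p.2) : B).
Proof.
move=> mphi; apply: (measurableT_comp (@mF k) (_ : measurable_fun setT
  (fun p : B * E => (p.1, phi p.2) : B * Gk k))).
by apply: measurable_fun_pair => //; exact: measurableT_comp.
Qed.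

Let mFapp k (e : measure_display) (E : measurableType e) (u : E -> B) (phi : E -> Gk k) :
  measurable_fun setT u -> measurable_fun setT phi ->
  measurable_fun setT (fun w : E => F k (u w) (phi w) : B).
Proof.
move=> mu mphi; apply: (measurableT_comp (@mF k) (_ : measurable_fun setT
  (fun w : E => (u w, phi w) : B * Gk k))).
exact: measurable_fun_pair.
Qed.

(** The identity maps from [Om] to [Hk k] and to [Gk k] are independent by [other_events_indep]. *)
Lemma integral_freeze k (h : Hk k * Gk k -> \bar R) :
  measurable_fun [set: Hk k * Gk k] h -> (forall z, 0 <= h z) ->
  \int[P]_w h (w, w) = \int[P]_w \int[P]_w' h (w, w').
Proof.
move=> mh h0; apply: (@integral_indep R _ _ _ Om (Hk k) (Gk k) P id id) => //.
move=> A C mA mC; rewrite !preimage_id.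
by apply: (other_events_indep hG iG mA); rewrite -(sigma_algebra_id (hG k).1).
Qed.

(* A function of [H_k] and [G_k] keeps its law when the randomness in [G_k] is
   replaced by an independent copy. *)
Lemma msq_freeze k (a b : Hk k * Gk k -> B) :
  measurable_fun setT a -> measurable_fun setT b ->
  msq P (fun w => a (w, w)) (fun w => b (w, w)) = msq (P \x P) (a : Om * Om -> _) b.
Proof.
move=> ma mb; rewrite msq_prod1.
- by rewrite /msq (integral_freeze (measurable_enorm_sqrB ma mb))// => z; rewrite lee_fin sqr_ge0.
- exact: measurableT_comp ma (@idHGprod k).
- exact: measurableT_comp mb (@idHGprod k).
Qed.

Let mT : measurable_fun [set: B] (T : B -> B) := nonexpansive_measurable hT.

Let coarseH k (e : measure_display) (E : measurableType e) (f : Hk k -> E) :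
  measurable_fun setT f -> measurable_fun setT (f : Om -> E).
Proof. by move=> mf; exact: measurableT_comp mf (@idH k). Qed.

Let msq_freeze_le k (a b : Hk k * Gk k -> B) (c : Om -> \bar R) :
  measurable_fun setT a -> measurable_fun setT b -> measurable_fun setT c ->
  (forall w, msq P (fun w' => a (w, w')) (fun w' => b (w, w')) <= c w) ->
  msq P (fun w => a (w, w)) (fun w => b (w, w)) <= \int[P]_w c w.
Proof.
move=> ma mb mc abc; rewrite msq_freeze//.
have ma' : measurable_fun [set: Om * Om] (a : Om * Om -> B).
  exact: measurableT_comp ma (@idHGprod k).
have mb' : measurable_fun [set: Om * Om] (b : Om * Om -> B).
  exact: measurableT_comp mb (@idHGprod k).
rewrite msq_prod1//; apply: ge0_le_integral => //.
- by move=> w _; exact: msq_ge0.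
- exact: measurable_msq1.
Qed.

(** Once the other sources are frozen, [u] and [v] are deterministic; the variance hypothesis
    applies to each frozen outcome and is then integrated. *)
Lemma F_var_indep (k : 'I_N.-1) (u v : Hk k -> B) :
  measurable_fun setT u -> measurable_fun setT v ->
  msq P (fun w => F k (u w) w) (fun w => T (v w)) <= msq P u v + (sigma2 k)%:E.
Proof.
move=> mu mv; have muv := measurable_enorm_sqrB (coarseH mu) (coarseH mv).
have s0 := sigma2_ge0 (ltn_ord k).
have -> : msq P u v + (sigma2 k)%:E =
    \int[P]_w ((enorm ((u w : 'rV[R]_n) - (v w : 'rV[R]_n)) ^+ 2)%:E + (sigma2 k)%:E).
  rewrite ge0_integralD//; last by move=> w _; rewrite lee_fin sqr_ge0.
  by rewrite integral_cst//= probability_setT mule1.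
apply: (@msq_freeze_le k (fun z => F k (u z.1) z.2) (fun z => T (v z.1))).
- by apply: mFapp => //; exact: measurableT_comp.
- by apply: (measurableT_comp mT); exact: measurableT_comp.
- exact: emeasurable_funD.
- by move=> w; rewrite -EFinD; exact: (@F_var k (u w) (v w) (ltn_ord k)).
Qed.

Lemma F_lip_indep (k : 'I_N.-1) (u v : Hk k -> B) :
  measurable_fun setT u -> measurable_fun setT v ->
  msq P (fun w => F k (u w) w) (fun w => F k (v w) w) <= msq P u v.
Proof.
move=> mu mv; have muv := measurable_enorm_sqrB (coarseH mu) (coarseH mv).
apply: (@msq_freeze_le k (fun z => F k (u z.1) z.2) (fun z => F k (v z.1) z.2)) => //.
- by apply: mFapp => //; exact: measurableT_comp.
- by apply: mFapp => //; exact: measurableT_comp.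
- by move=> w; exact: (@F_lip k (u w) (v w) (ltn_ord k)).
Qed.

Let X j w := (dual_iter N (fun i u => F i u w) x0 j).1.
Let Z j w := (dual_iter N (fun i u => F i u w) x0 j).2.
Let y k w := F k (X k w) w.

Let XS j : X j.+1 =
  (fun w => (N - j)%:R^-1 *: Z j w + (1 - (N - j)%:R^-1) *: y j w)%R.
Proof. by apply/funext => w; rewrite /X dual_iterS1. Qed.

Let ZS j : Z j.+1 =
  (fun w => (N - j)%:R^-1 *: y j w + (1 - (N - j)%:R^-1) *: Z j w)%R.
Proof. by apply/funext => w; rewrite /Z dual_iterS2. Qed.

(** The iterates up to step [k] involve only maps of index below [k]. *)
Let mXZ_H (k : 'I_N.-1) j : (j <= k)%N ->
  measurable_fun setT (X j : Hk k -> B) /\ measurable_fun setT (Z j : Hk k -> B).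
Proof.
move=> jk; apply: (@dual_iter_measurable R n N _ (Hk k) F) => i ij.
have iN : (i < N.-1)%N by rewrite (leq_trans ij)// ltnW// (leq_ltn_trans jk).
apply: (@mFsub (Ordinal iN) _ (Hk k) id); apply: idHG.
by rewrite -val_eqE/= ltn_eqF// (leq_trans ij).
Qed.

Let mXZ j : (j <= N.-1)%N ->
  measurable_fun setT (X j : Om -> B) /\ measurable_fun setT (Z j : Om -> B).
Proof.
move=> jN; apply: (@dual_iter_measurable R n N _ Om F) => i ij.
have iN := leq_trans ij jN.
exact: (@mFsub (Ordinal iN) _ Om id (@idG (Ordinal iN))).
Qed.

Let my k : (k < N.-1)%N -> measurable_fun setT (y k : Om -> B).
Proof.
move=> kN; have [mX _] := mXZ (ltnW kN).
exact: (@mFapp (Ordinal kN) _ _ (X k) id mX (@idG _)).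
Qed.

(** Finite second moments later allow equal terms to be cancelled from both sides of an inequality
    in the extended reals. *)
Lemma dual_iter_msq_fin j : (j <= N.-1)%N ->
  msq P (X j) (fun=> x0) < +oo /\ msq P (Z j) (fun=> x0) < +oo.
Proof.
have mc (u : B) : measurable_fun [set: Om] (fun=> u) by exact: measurable_cst.
have msqcc u v : msq P (fun=> u) (fun=> v) = (enorm (u - v) ^+ 2)%:E.
  by rewrite /msq integral_cst//= probability_setT mule1.
elim: j => [_|j IH jN].
  by rewrite /X /Z/= msqcc ltry.
have [Xj Zj] := IH (ltnW jN).
have [mXj mZj] := mXZ (ltnW jN).
have Yj : msq P (y j) (fun=> x0) < +oo.
  (* The variance hypothesis measures distances to values of [T], hence the detour through
     [T x0]. *)
  have h := msq_triangle P (my jN) (mc (T x0)) (mc x0). apply: (le_lt_trans h).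
  have h3 : 2%:E * msq P (fun=> T x0) (fun=> x0) < +oo by rewrite msqcc; exact: ltry.
  apply: (lte_add_pinfty _ h3); apply: lte_mul_pinfty; [by rewrite lee_fin|by []|].
  have [mXH _] := @mXZ_H (Ordinal jN) j (leqnn j).
  have mcH : measurable_fun [set: Hk (Ordinal jN)] (fun=> x0 : B) by exact: measurable_cst.
  have h2 : msq P (y j) (fun=> T x0) <= msq P (X j) (fun=> x0) + (sigma2 j)%:E
    by exact: (@F_var_indep (Ordinal jN) (X j) (fun=> x0) mXH mcH).
  apply: (le_lt_trans h2).
  exact: (lte_add_pinfty Xj (ltry _)).
pose M := maxe (msq P (Z j) (fun=> x0)) (msq P (y j) (fun=> x0)).
have Moo : M < +oo by rewrite /M gt_max Zj Yj.
have c01 := step_size_itv R jN.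
(* The constant [x0] is rewritten as a convex combination to match [msq_convex]. *)
have cE (u : 'rV[R]_n) (c : R) : (fun=> u) = (fun _ : Om => c *: u + (1 - c) *: u)%R.
  by apply/funext => w; rewrite -scalerDl addrCA subrr addr0 scale1r.
split; apply: le_lt_trans Moo.
- rewrite XS (cE x0 ((N - j)%:R^-1)%R); apply: (msq_convex c01 mZj (mc x0) (my jN) (mc x0)).
    by rewrite le_max lexx.
  by rewrite le_max lexx orbT.
- rewrite ZS (cE x0 ((N - j)%:R^-1)%R); apply: (msq_convex c01 (my jN) (mc x0) mZj (mc x0)).
    by rewrite le_max lexx orbT.
  by rewrite le_max lexx.
Qed.

(** * The run with one map replaced by an independent copy *)

Section ghost_copy.
Variable k : 'I_N.-1.
(* On [Om * Om], the second coordinate drives the copy of [F k] and the first one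
   drives all the other maps. *)
Let F' i u (z : Om * Om) := if i == k :> nat then F k u z.2 else F i u z.1.
Let X' j z := (dual_iter N (fun i u => F' i u z) x0 j).1.
Let Z' j z := (dual_iter N (fun i u => F' i u z) x0 j).2.

Let XZ'_early j z : (j <= k)%N -> X' j z = X j z.1 /\ Z' j z = Z j z.1.
Proof.
move=> jk; rewrite /X' /Z' (@eq_dual_iter _ _ _ _ (fun i u => F i u z.1))//.
by move=> i u ij; rewrite /F' ltn_eqF// (leq_trans ij).
Qed.

(** On the diagonal the copy of [F k] is [F k] itself, so the rerun is the original run. *)
Let X'_diag j w : X' j (w, w) = X j w.
Proof.
rewrite /X' (@eq_dual_iter _ _ _ _ (fun i u => F i u w))// => i u _.
by rewrite /F'; case: eqP => // ->.
Qed.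

Let mX'_prod j : (j <= N.-1)%N ->
  measurable_fun [set: Hk k * Gk k] (X' j : Hk k * Gk k -> B).
Proof.
move=> jN; apply: (@dual_iter_measurable R n N _ (Hk k * Gk k)%type F' _ _ _).1.
move=> i ij; rewrite /F'; have [ik|ik] := eqVneq i k.
  exact: (@mFsub k _ (Hk k * Gk k)%type snd measurable_snd).
have iN := leq_trans ij jN.
apply: (@mFsub (Ordinal iN) _ (Hk k * Gk k)%type fst).
by apply: (measurableT_comp (@idHG k (Ordinal iN) _) measurable_fst).
Qed.

(** For fixed [w'] the copy of [F k] is a deterministic map, and the other maps involved have index
    below [l]; this lets [F_lip_indep] apply to the rerun at step [l]. *)
Let mXZ'_section (l : 'I_N.-1) j w' : (k < l)%N -> (j <= l)%N ->
  measurable_fun setT ((fun w => X' j (w, w')) : Hk l -> B).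
Proof.
move=> kl jl.
apply: (@dual_iter_measurable R n N _ (Hk l) (fun i u w => F' i u (w, w')) _ _ _).1.
move=> i ij; rewrite /F'; have [ik|ik] := eqVneq i k.
  apply: (@mFsub k _ (Hk l) (fun=> w')); exact: measurable_cst.
have iN : (i < N.-1)%N by rewrite (leq_trans ij)// ltnW// (leq_ltn_trans jl).
apply: (@mFsub (Ordinal iN) _ (Hk l) id); apply: idHG.
by rewrite -val_eqE/= ltn_eqF// (leq_trans ij).
Qed.

Let mXZ'_Om j w' : (j <= N.-1)%N ->
  measurable_fun [set: Om] ((fun w => X' j (w, w')) : Om -> B) /\
  measurable_fun [set: Om] ((fun w => Z' j (w, w')) : Om -> B).
Proof.
move=> jN.
apply: (@dual_iter_measurable R n N _ Om (fun i u w => F' i u (w, w')) _ _ _).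
move=> i ij; rewrite /F'; have [ik|ik] := eqVneq i k.
  apply: (@mFsub k _ Om (fun=> w')); exact: measurable_cst.
have iN := leq_trans ij jN.
exact: (@mFsub (Ordinal iN) _ Om id (@idG (Ordinal iN))).
Qed.

Let mY'_Om w' : measurable_fun [set: Om] ((fun w => F k (X k w) w') : Om -> B).
Proof.
have [mX _] := mXZ (ltnW (ltn_ord k)).
apply: (@mFapp k _ Om (X k) (fun=> w') mX); exact: measurable_cst.
Qed.

(** The runs agree up to step [k], where their outputs differ by the right side; each later map is
    common to both and does not expand mean-square distances, nor do the convex combinations. *)
Lemma ghost_stability j w' : (k <= j)%N -> (j <= N.-1)%N ->
  msq P (X j) (fun w => X' j (w, w')) <= msq P (y k) (fun w => F k (X k w) w') /\
  msq P (Z j) (fun w => Z' j (w, w')) <= msq P (y k) (fun w => F k (X k w) w').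
Proof.
set Delta := msq P (y k) _ => kj jN.
have base : msq P (X k) (fun w => X' k (w, w')) <= Delta /\
            msq P (Z k) (fun w => Z' k (w, w')) <= Delta.
  rewrite (_ : (fun w => X' k (w, w')) = X k); last first.
    by apply/funext => w; have [->] := @XZ'_early k (w, w') (leqnn k).
  rewrite (_ : (fun w => Z' k (w, w')) = Z k); last first.
    by apply/funext => w; have [_ ->] := @XZ'_early k (w, w') (leqnn k).
  by rewrite !msq_refl; split; exact: msq_ge0.
elim: j kj jN => [|j IH] kj jN; first by move: kj; rewrite leqn0 => /eqP <-.
move: kj; rewrite leq_eqVlt => /orP[/eqP <- //|]; rewrite ltnS => kj.
have [Xj Zj] := IH kj (ltnW jN).
have [mXj mZj] := mXZ (ltnW jN).
have [mX'j mZ'j] := @mXZ'_Om j w' (ltnW jN).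
pose y' w := F' j (X' j (w, w')) (w, w').
have [Yj my'] : msq P (y j) y' <= Delta /\ measurable_fun [set: Om] (y' : Om -> B).
  have [jk|jk] := eqVneq (k : nat) j.
    rewrite (_ : y' = fun w => F k (X k w) w'); last first.
      apply/funext => w; rewrite /y' /F' -jk eqxx.
      by have [->] := @XZ'_early k (w, w') (leqnn k).
    by rewrite -jk; split; [exact: lexx|exact: mY'_Om].
  have kj' : (k < j)%N by rewrite ltn_neqAle jk.
  rewrite (_ : y' = fun w => F j (X' j (w, w')) w); last first.
    by apply/funext => w; rewrite /y' /F' eq_sym (negbTE jk).
  split; last exact: (@mFapp (Ordinal jN) _ Om _ id mX'j (@idG (Ordinal jN))).
  have [mXH _] := @mXZ_H (Ordinal jN) j (leqnn j).
  apply: le_trans Xj.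
  exact: (@F_lip_indep (Ordinal jN) _ _ mXH (@mXZ'_section (Ordinal jN) j w' kj' (leqnn j))).
have c01 := step_size_itv R jN.
rewrite XS ZS; split.
  rewrite (_ : (fun w => X' j.+1 (w, w')) = fun w =>
    (N - j)%:R^-1 *: Z' j (w, w') + (1 - (N - j)%:R^-1) *: y' w)%R.
    exact: (msq_convex c01 mZj mZ'j (my jN) my' Zj Yj).
  by apply/funext => w; exact: dual_iterS1.
rewrite (_ : (fun w => Z' j.+1 (w, w')) = fun w =>
  (N - j)%:R^-1 *: y' w + (1 - (N - j)%:R^-1) *: Z' j (w, w'))%R.
  exact: (msq_convex c01 (my jN) my' mZj mZ'j Yj Zj).
by apply/funext => w; exact: dual_iterS2.
Qed.

(** Doubled letters denote the original run on the product space; [yg] and [pg] are the output of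
    the copy and the last iterate of the rerun. *)
Let Q := (P \x P)%E.
Let p w := X N.-1 w.
Let A := msq P (y k) (fun w => T (p w)).
Let BB := msq P (X k) p.
Let s := (sigma2 k)%:E.
Let yy (z : Om * Om) := y k z.1.
Let yg (z : Om * Om) := F k (X k z.1) z.2.
Let xx (z : Om * Om) := X k z.1.
Let pp (z : Om * Om) := p z.1.
Let pg (z : Om * Om) := X' N.-1 z.

Let mX_Hk : measurable_fun setT (X k : Hk k -> B).
Proof. by have [] := @mXZ_H k k (leqnn k). Qed.

Let mX_Om : measurable_fun setT (X k : Om -> B).
Proof. by have [] := mXZ (ltnW (ltn_ord k)). Qed.

Let mp : measurable_fun setT (p : Om -> B).
Proof. by have [] := mXZ (leqnn N.-1). Qed.

Let mTp : measurable_fun setT ((fun w => T (p w)) : Om -> B).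
Proof. exact: (measurableT_comp mT mp). Qed.

Let mxx : measurable_fun setT (xx : Om * Om -> B).
Proof. exact: (measurableT_comp mX_Om measurable_fst). Qed.

Let mpp : measurable_fun setT (pp : Om * Om -> B).
Proof. exact: (measurableT_comp mp measurable_fst). Qed.

Let myy : measurable_fun setT (yy : Om * Om -> B).
Proof. exact: (measurableT_comp (my (ltn_ord k)) measurable_fst). Qed.

Let myg_HG : measurable_fun setT (yg : Hk k * Gk k -> B).
Proof.
exact: (@mFapp k _ (Hk k * Gk k)%type xx snd
  (measurableT_comp mX_Hk measurable_fst) measurable_snd).
Qed.

Let myg : measurable_fun setT (yg : Om * Om -> B).
Proof. exact: (measurableT_comp myg_HG (@idHGprod k)). Qed.

Let mpg_HG : measurable_fun setT (pg : Hk k * Gk k -> B).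
Proof. exact: mX'_prod. Qed.

Let mpg : measurable_fun setT (pg : Om * Om -> B).
Proof. exact: (measurableT_comp mpg_HG (@idHGprod k)). Qed.

Let mTpg : measurable_fun setT ((fun z => T (pg z)) : Om * Om -> B).
Proof. exact: (measurableT_comp mT mpg). Qed.

Let mTpp : measurable_fun setT ((fun z => T (pp z)) : Om * Om -> B).
Proof. exact: (measurableT_comp mT mpp). Qed.

(** Freezing replaces the diagonal, where both runs coincide, by the product measure, where the
    rerun has its own source for [F k]. *)
Let ghost_law : A = msq Q yg (fun z => T (pg z)).
Proof.
have := @msq_freeze k yg (fun z => T (pg z)) myg_HG (measurableT_comp mT mpg_HG).
move=> <-; congr (msq P _ _); apply/funext => w.
by rewrite /pg X'_diag.
Qed.

Let ghost_law_dist : BB = msq Q xx pg.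
Proof.
have := @msq_freeze k xx pg (measurableT_comp mX_Hk measurable_fst) mpg_HG.
move=> <-; congr (msq P _ _); apply/funext => w.
by rewrite /pg X'_diag.
Qed.

Let int_cst (c : \bar R) : \int[P]_w c = c.
Proof. by rewrite integral_cst//= probability_setT mule1. Qed.

(** With the copy frozen at [w'], the last iterate of the rerun is measurable for the other sources,
    so [F_var_indep] applies to it. *)
Let var_ghost_point : msq Q yy (fun z => T (pg z)) <= msq Q xx pg + s.
Proof.
rewrite (msq_prod2 _ mxx mpg) (msq_prod2 _ myy mTpg).
have s0 : 0 <= s by rewrite lee_fin; exact: sigma2_ge0.
have m1 := measurable_msq2 P mxx mpg.
rewrite -[X in _ + X]int_cst -ge0_integralD//; last by move=> w _; exact: msq_ge0.
apply: ge0_le_integral; first exact: measurableT.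
- by move=> w _; exact: msq_ge0.
- exact: (measurable_msq2 P myy mTpg).
- exact: emeasurable_funD.
move=> w' _; apply: (@F_var_indep k (X k) (fun w => pg (w, w')) mX_Hk).
exact: (measurableT_comp mpg_HG (pair2_measurable _)).
Qed.

(** With the original run frozen at [w], only the copy is random and both points are fixed: the
    variance hypothesis applies directly. *)
Let var_ghost_map : msq Q yg (fun z => T (pp z)) <= BB + s.
Proof.
rewrite (msq_prod1 _ myg mTpp).
have s0 : 0 <= s by rewrite lee_fin; exact: sigma2_ge0.
have m1 := measurable_enorm_sqrB mX_Om mp.
rewrite -[X in _ + X]int_cst /BB /msq -ge0_integralD//; last first.
  by move=> w _; rewrite lee_fin sqr_ge0.
apply: ge0_le_integral; first exact: measurableT.
- by move=> w _; exact: msq_ge0.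
- exact: (measurable_msq1 P myg mTpp).
- exact: emeasurable_funD.
by move=> w _; rewrite -EFinD; exact: (@F_var k (X k w) (p w) (ltn_ord k)).
Qed.

(* Freezing the past and adding a third copy of the randomness in [G_k] gives two
   independent values of [F k] at a fixed point. *)
Let ghost_distance : msq Q yy yg <= 2%:E * s.
Proof.
rewrite (msq_prod2 _ myy myg).
pose f (z : Om * Om) := msq P (F k (X k z.1)) (fun=> F k (X k z.1) z.2).
have mf : measurable_fun setT f.
  pose a (q : (Om * Om) * Om) : B := F k (X k q.1.1) q.2.
  pose b (q : (Om * Om) * Om) : B := F k (X k q.1.1) q.1.2.
  have mX3 : measurable_fun setT ((fun q => X k q.1.1) : (Om * Om) * Om -> B).
    exact: (measurableT_comp mxx measurable_fst).
  have ma : measurable_fun setT a.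
    apply: (@mFapp k _ ((Om * Om) * Om)%type _ snd mX3).
    exact: (measurableT_comp (@idG k) measurable_snd).
  have mb : measurable_fun setT b.
    exact: (measurableT_comp myg measurable_fst).
  apply: (measurable_fun_fubini_tonelli_F _ (measurable_enorm_sqrB ma mb)).
  by move=> q; rewrite lee_fin sqr_ge0.
have f0 z : 0 <= f z by exact: msq_ge0.
(* With [w'] fixed, the original output is separated into its past and a fresh source for [F k]. *)
have -> : \int[P]_w' msq P (fun w => yy (w, w')) (fun w => yg (w, w')) =
    \int[P]_w' \int[P]_w f (w, w').
  apply: eq_integral => w' _.
  pose b (z : Hk k * Gk k) : B := F k (X k z.1) w'.
  have mb : measurable_fun setT b.
    apply: (@mFapp k _ (Hk k * Gk k)%type xx (fun=> w')).
      exact: (measurableT_comp mX_Hk measurable_fst).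
    exact: measurable_cst.
  have -> : msq P (fun w => yy (w, w')) (fun w => yg (w, w')) = msq Q yg b.
    exact: (@msq_freeze k yg b myg_HG mb).
  by rewrite (msq_prod1 _ myg (measurableT_comp mb (@idHGprod k))).
rewrite -fubini_tonelli// -[leRHS]int_cst; apply: ge0_le_integral; first exact: measurableT.
- by move=> w _; exact: integral_ge0.
- exact: (measurable_fun_fubini_tonelli_F f).
- exact: measurable_cst.
move=> w _.
have mFw : measurable_fun setT ((fun w' => F k (X k w) w') : Om -> B).
  by apply: (@mFapp k _ Om (fun=> X k w) id _ (@idG k)); exact: measurable_cst.
(* With the centre [T (X k w)], the variance hypothesis at [u = v] leaves only [sigma2 k]. *)
apply: (le_trans (sqr_dist_copies P (T (X k w)) mFw)).
apply: lee_wpmul2l => //; apply: (le_trans (@F_var k _ _ (ltn_ord k))).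
by rewrite subrr enorm_sqr big1 ?add0r// => i _; rewrite mxE expr0n.
Qed.

Let ghost_stability_prod : msq Q pp pg <= 2%:E * s.
Proof.
apply: le_trans ghost_distance.
rewrite (msq_prod2 _ myy myg) (msq_prod2 _ mpp mpg).
apply: ge0_le_integral; first exact: measurableT.
- by move=> w _; exact: msq_ge0.
- exact: (measurable_msq2 P mpp mpg).
- exact: (measurable_msq2 P myy myg).
move=> w' _.
exact: (proj1 (@ghost_stability N.-1 w' (ltnW (ltn_ord k)) (leqnn _))).
Qed.

(** The exchange inequality gives [2 A <= 2 BB + 6 s]: each of the two mixed terms contributes one
    [s] and each of the two distances [2 s]. Halving gives the factor 3. *)
Lemma ghost_bound : A <= BB + (3 * sigma2 k)%:E.
Proof.
have yyE : msq Q yy (fun z => T (pp z)) = A.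
  rewrite (msq_prod1 _ myy mTpp) /A [RHS]/msq; apply: eq_integral => w _.
  by rewrite /msq /yy /pp /= int_cst.
have h : A + A <= BB + s + (BB + s) + (2%:E * s + 2%:E * s).
  rewrite {1}ghost_law -{1}yyE addeC.
  apply: (le_trans (msq_exchange Q myy myg mTpp mTpg)).
  apply: leeD; apply: leeD.
  - by rewrite ghost_law_dist; exact: var_ghost_point.
  - exact: var_ghost_map.
  - exact: ghost_distance.
  - apply: le_trans ghost_stability_prod.
    exact: (msq_nonexpansive Q hT mpp mpg).
have : 0 <= A by exact: msq_ge0.
(* If [BB] is infinite there is nothing to prove; if it is finite, [h] forces [A] to be finite and
   can be halved. *)
move: h; rewrite /s; case: BB (msq_ge0 P (X k) p : 0 <= BB) => [b| |]//; last first.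
  by move=> _ _ _; rewrite addye// leey.
move=> _; case: A => [a| |]//; rewrite -!EFinM -!EFinD ?lee_fin// => h _; lra.
Qed.

End ghost_copy.

(** * The rate *)

Let integral_lincomb (m : nat) (f0 : Om -> R) (c : 'I_m -> R) (f : 'I_m -> Om -> R) :
  measurable_fun setT (EFin \o f0) -> (forall w, (0 <= f0 w)%R) ->
  (forall i, measurable_fun setT (EFin \o f i)) -> (forall i w, (0 <= f i w)%R) ->
  (forall i, (0 <= c i)%R) ->
  \int[P]_w (f0 w + \sum_(i < m) c i * f i w)%:E =
  \int[P]_w (f0 w)%:E + \sum_(i < m) (c i)%:E * \int[P]_w (f i w)%:E.
Proof.
move=> mf0 f00 mf f_0 c0.
rewrite [LHS](eq_integral (fun w => (f0 w)%:E + \sum_(i < m) (c i)%:E * (f i w)%:E)).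
  have mcf i : measurable_fun setT (fun w => (c i)%:E * (f i w)%:E).
    by apply: measurable_funeM; exact: mf.
  have cf0 i w : 0 <= (c i)%:E * (f i w)%:E by rewrite mule_ge0 ?lee_fin.
  rewrite ge0_integralD//; last 2 first.
  - by move=> w _; apply: sume_ge0 => i _.
  - exact: emeasurable_sum.
  congr (_ + _); rewrite ge0_integral_sum//; apply: eq_bigr => i _.
  rewrite ge0_integralZl_EFin//; first by move=> w _; rewrite lee_fin.
  exact: mf.
  by move=> w _; rewrite lee_fin.
move=> w _; rewrite EFinD; congr (_ + _); rewrite -sumEFin.
by apply: eq_bigr => i _; rewrite EFinM.
Qed.

(** After integrating [dual_iter_bound] and inserting [ghost_bound], the terms [2 a_k E|x_k - p|^2]
    appear on both sides and cancel; the noise keeps the factor [2 * 3 = 6]. *)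
Lemma dual_iter_rate (xs : 'rV[R]_n) : xs = T xs -> (2 <= N)%N ->
  msq P (X N.-1) (fun w => T (X N.-1 w)) <=
  (4 * enorm (x0 - xs) ^+ 2 / N%:R ^+ 2 +
   6 * \sum_(0 <= k < N.-1) weight R N k * sigma2 k)%:E.
Proof.
move=> xsE N2.
pose p := X N.-1; pose C := (4 * enorm (x0 - xs) ^+ 2 / N%:R ^+ 2)%R.
pose c (k : 'I_N.-1) := (2 * weight R N k)%R.
have c0 k : (0 <= c k)%R by rewrite mulr_ge0// weight_ge0.
have C0 : (0 <= C)%R by apply: divr_ge0; [apply: mulr_ge0 => //|]; exact: sqr_ge0.
have [mp _] := mXZ (leqnn N.-1).
have mTp := measurableT_comp mT mp.
have mXk (k : 'I_N.-1) := proj1 (mXZ (ltnW (ltn_ord k))).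
have mdB (k : 'I_N.-1) := measurable_enorm_sqrB (mXk k) mp.
have mdA (k : 'I_N.-1) := measurable_enorm_sqrB (my (ltn_ord k)) mTp.
have mdg := measurable_enorm_sqrB mp mTp.
(* Finiteness, needed for the cancellation, comes from the triangle inequality through [x0]. *)
have Bfin (k : 'I_N.-1) : msq P (X k) p \is a fin_num.
  rewrite ge0_fin_numE ?msq_ge0//.
  have mc : measurable_fun [set: Om] (fun=> x0 : B) by exact: measurable_cst.
  have [Xk _] := dual_iter_msq_fin (ltnW (ltn_ord k)).
  have [Xp _] := dual_iter_msq_fin (leqnn N.-1).
  have h := msq_triangle P (mXk k) mc mp.
  apply: (le_lt_trans h); apply: lte_add_pinfty.
    by apply: lte_mul_pinfty; [rewrite lee_fin|by []|exact: Xk].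
  apply: lte_mul_pinfty; [by rewrite lee_fin|by []|rewrite msqC; exact: Xp].
pose b k := fine (msq P (X (k : 'I_N.-1)) p).
have bE k : msq P (X (k : 'I_N.-1)) p = (b k)%:E by rewrite fineK.
have bound : msq P p (fun w => T (p w)) + \sum_(k < N.-1) (c k)%:E * msq P (X k) p <=
    C%:E + \sum_(k < N.-1) (c k)%:E * msq P (y k) (fun w => T (p w)).
  have s0 (u : 'rV[R]_n) : (0 <= enorm u ^+ 2)%R by exact: sqr_ge0.
  have iC : \int[P]_w C%:E = C%:E by rewrite integral_cst//= probability_setT mule1.
  have eL := @integral_lincomb N.-1 (fun w => enorm (p w - T (p w)) ^+ 2)%R c
    (fun k w => enorm (X k w - p w) ^+ 2)%R mdg (fun w => s0 _) mdB (fun k w => s0 _) c0.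
  have eR := @integral_lincomb N.-1 (fun=> C) c
    (fun k w => enorm (y k w - T (p w)) ^+ 2)%R (measurable_cst _) (fun=> C0)
    mdA (fun k w => s0 _) c0.
  rewrite iC in eR; rewrite /msq -[leLHS]eL -[leRHS]eR.
  have mdgR := (measurable_EFinP _ _).1 mdg.
  have mdAR k := (measurable_EFinP _ _).1 (mdA k).
  have mdBR k := (measurable_EFinP _ _).1 (mdB k).
  apply: ge0_le_integral; first exact: measurableT.
  - move=> w _; rewrite lee_fin; apply: addr_ge0 => //.
    by apply: sumr_ge0 => i _; exact: mulr_ge0.
  - apply/measurable_EFinP; apply: measurable_funD; first exact: mdgR.
    apply: measurable_sum => i; apply: measurable_funM; first exact: measurable_cst.
    exact: mdBR.
  - apply/measurable_EFinP; apply: measurable_funD; first exact: measurable_cst.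
    apply: measurable_sum => i; apply: measurable_funM; first exact: measurable_cst.
    exact: mdAR.
  - move=> w _; rewrite lee_fin.
    have := @dual_iter_bound R n N (fun i u => F i u w) x0 T xs hT xsE N2 _ erefl.
    rewrite !big_mkord !mulr_sumr.
    under eq_bigr do rewrite mulrA.
    by under [X in (_ <= _ + X)%R]eq_bigr do rewrite mulrA.
have ghost : \sum_(k < N.-1) (c k)%:E * msq P (y k) (fun w => T (p w)) <=
    \sum_(k < N.-1) (c k * (b k + 3 * sigma2 k))%:E.
  apply: lee_sum => k _; rewrite [leRHS]EFinM.
  apply: lee_wpmul2l; first by rewrite lee_fin.
  by rewrite EFinD -bE; exact: ghost_bound.
have := le_trans bound (leeD (lexx C%:E) ghost).
under eq_bigr do rewrite bE -EFinM.
rewrite !sumEFin -EFinD.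
(* The right side is finite, hence so is the left, and the comparison becomes one between reals. *)
case: (msq P p _) (msq_ge0 P p (fun w => T (p w))) => [a| |]// _.
rewrite -EFinD !lee_fin.
under [X in (_ <= _ + X)%R -> _]eq_bigr do rewrite mulrDr.
rewrite big_split/= big_mkord mulr_sumr.
rewrite [X in (_ <= C + (_ + X))%R -> _](eq_bigr (fun k : 'I_N.-1 => 6 * (weight R N k * sigma2 k))%R).
  by rewrite /C; lra.
by move=> k _; rewrite /c; ring.
Qed.

End ghost_step.

(** * Transfer to the given recursion *)

Theorem theorem2p2 (R : realType) (d : nat)
    (disp : measure_display) (Omega : measurableType disp)
    (P : probability Omega R)
    (T : 'rV[R]_d -> 'rV[R]_d) (xstar : 'rV[R]_d)
    (hT : nonexpansive T) (hxstar : xstar = T xstar)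
    (N : nat) (hN : (2 <= N)%N)
    (Tk : nat -> 'rV[R]_d -> Omega -> 'rV[R]_d)
    (hmeas : forall k : nat, (k < N.-1)%N -> jointly_measurable (Tk k))
    (hindep : independent_random_maps P (fun k : 'I_(N.-1) => Tk k))
    (sigma2 : nat -> R)
    (hsigma2 : forall k : nat, (k < N.-1)%N -> 0 <= sigma2 k)
    (hvar : forall (k : nat) (u v : 'rV[R]_d), (k < N.-1)%N ->
       ('E_P[fun w => (enorm (Tk k u w - T v) ^+ 2)%R]
          <= (enorm (u - v) ^+ 2 + sigma2 k)%:E)%E)
    (hlip : forall (k : nat) (u v : 'rV[R]_d), (k < N.-1)%N ->
       ('E_P[fun w => (enorm (Tk k u w - Tk k v w) ^+ 2)%R]
          <= (enorm (u - v) ^+ 2)%:E)%E)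
    (D : R) (x0 : 'rV[R]_d) (hD : enorm (x0 - xstar) <= D)
    (x : nat -> Omega -> 'rV[R]_d)
    (hx0 : forall w : Omega, x 0%N w = x0)
    (hx : forall (k : nat) (w : Omega), (k < N.-1)%N ->
       x k.+1 w = x k w + ((N - k - 1)%:R / (N - k)%:R) *:
         (Tk k (x k w) w - (if k is j.+1 then Tk j (x j w) w else x0))) :
  ('E_P[fun w => (enorm (x N.-1 w - T (x N.-1 w)) ^+ 2)%R]
     <= (4 * D ^+ 2 / N%:R ^+ 2
         + 6 * \sum_(0 <= k < N.-1)
                 (((N - k)%:R * (N - k - 1)%:R)^-1 * sigma2 k))%:E)%E.
Proof.
have [G [hG iG mG]] := hindep.
(* Outcome by outcome, the given recursion has the same last iterate as [dual_iter]. *)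
have X0E w := @dual_iterE R d N (fun i u => Tk i u w) x0 (x ^~ w) (ltnW hN)
  (hx0 w) (fun k => hx k w) N.-1 (leqnn _).
have Tk_var k u v : (k < N.-1)%N ->
    (msq P (Tk k u) (fun=> T v) <= (enorm (u - v) ^+ 2 + sigma2 k)%:E)%E.
  by move=> kN; have := hvar k u v kN; rewrite unlock.
have Tk_lip k u v : (k < N.-1)%N ->
    (msq P (Tk k u) (Tk k v) <= (enorm (u - v) ^+ 2)%:E)%E.
  by move=> kN; have := hlip k u v kN; rewrite unlock.
have rate := dual_iter_rate x0 hT hG iG mG hsigma2 Tk_var Tk_lip hxstar hN.
rewrite unlock; under eq_integral do rewrite X0E.
apply: (le_trans rate); rewrite lee_fin lerD2r ler_pM2r ?invr_gt0 ?exprn_gt0 ?ltr0n//; last by lia.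
by rewrite ler_pM2l// lerXn2r ?nnegrE ?enorm_ge0// (le_trans (enorm_ge0 _) hD).
Qed.
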